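(* Let $A$ be a regular system of divisors, $f:\mathbb N\to\mathbb C$ an arbitrary function, $n\in\mathbb N$, and let $\chi$ be a Dirichlet character modulo $n$ with conductor $d$ (so $d\mid n$). Then \[ \sum_{j=1}^n f\big((j-1,n)_A\big)\chi(j)=\varphi(n)\sum_{\substack{\delta\in\mathbb N\\ d\delta\in A(n)}}\frac{(\mu_A*_Af)(d\delta)}{\varphi(d\delta)}, \] where $\varphi$ is Euler's function. In particular, if $\chi$ is a primitive character modulo $n$, then \[ \sum_{j=1}^n f\big((j-1,n)_A\big)\chi(j)=(\mu_A*_Af)(n). \]
   Context: A regular system of divisors is a family $A=(A(n))_{n\in\mathbb N}$, where each $A(n)$ is a set of positive divisors of $n$, such that: (i) $A(1)=\{1\}$ and $A(mn)=\{de: d\in A(m), e\in A(n)\}$ whenever $\gcd(m,n)=1$; (ii) for every prime power $p^a$ ($a\ge1$) there is a divisor $t=t_A(p^a)$ of $a$ such that $A(p^{it})=\{1,p^t,\dots,p^{it}\}$ for every $0\le i\le a/t$. The $A$-convolution of $f,g:\mathbb N\to\mathbb C$ is $(f*_Ag)(n)=\sum_{d\in A(n)}f(d)g(n/d)$; $\mu_A$ is the $*_A$-inverse of the constant function $1$. For $j\in\mathbb Z$ (including $j=0$), $(j,n)_A=\max\{d\in\mathbb N: d\mid j,\ d\in A(n)\}$. *)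

(* Defs.v *)
From HB Require Import structures.
From mathcomp Require Import all_boot all_order all_algebra.
From mathcomp Require Import finmap.
From mathcomp Require Import reals complex.

Set Implicit Arguments.
Unset Strict Implicit.
Unset Printing Implicit Defensive.

Import Order.TTheory GRing.Theory Num.Theory.

(* The natural numbers of the theory are the positive integers; families and
   functions on [nat] have an irrelevant value at 0. *)
Record regular_system (A : nat -> {fset nat}) : Prop := RegularSystem {
  regular_dvd : forall n d : nat, 0 < n -> d \in A n -> d %| n;
  regular_one : A 1 = [fset 1]%fset;
  regular_mul : forall m n : nat, 0 < m -> 0 < n -> coprime m n ->
    A (m * n) = [fset d * e | d in A m, e in A n]%fset;
  regular_type : forall p a : nat, prime p -> 0 < a ->
    exists2 t : nat, t %| a & forall i : nat, i <= a %/ t ->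
      A (p ^ (i * t)) = [fset p ^ (j * t) | j in iota 0 i.+1]%fset
}.

(* For regular [A] the set is never empty: it contains 1. *)
Definition gcdA (A : nat -> {fset nat}) (j : int) (n : nat) : nat :=
  \max_(d <- A n | (d%:Z %| j)%Z) d.

Local Open Scope ring_scope.

Definition convA (K : nzRingType) (A : nat -> {fset nat})
    (f g : nat -> K) (n : nat) : K :=
  \sum_(d <- A n) f d * g (n %/ d)%N.

(* [n |-> (n == 1%N)%:R] is the unit of [convA A]. *)
Definition inverseA (K : nzRingType) (A : nat -> {fset nat})
    (f g : nat -> K) : Prop :=
  forall n : nat, (0 < n)%N ->
    convA A f g n = (n == 1%N)%:R /\ convA A g f n = (n == 1%N)%:R.

Definition is_muA (K : nzRingType) (A : nat -> {fset nat})
    (mu : nat -> K) : Prop :=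
  inverseA A (fun=> 1) mu.

Record dirichlet_character (K : nzRingType) (n : nat) (chi : int -> K) : Prop :=
  DirichletCharacter {
    dirichletM : forall a b : int, chi (a * b) = chi a * chi b;
    dirichlet_periodic : forall a : int, chi (a + n%:Z) = chi a;
    dirichlet_neq0 : forall a : int, (chi a != 0) = coprimez a n
  }.

Definition induced_modulus (K : nzRingType) (n : nat) (chi : int -> K)
    (d : nat) : Prop :=
  (d %| n)%N /\
  forall a : int, coprimez a n -> (a = 1 %[mod d%:Z])%Z -> chi a = 1.

Definition conductor (K : nzRingType) (n : nat) (chi : int -> K)
    (d : nat) : Prop :=
  induced_modulus n chi d /\
  forall e : nat, induced_modulus n chi e -> (d <= e)%N.

Definition primitive_character (K : nzRingType) (n : nat) (chi : int -> K) :
    Prop :=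
  dirichlet_character n chi /\ conductor n chi n.

Section Existence.
Variables (A : nat -> {fset nat}) (regA : regular_system A).

Lemma coprime_ind (P : nat -> Prop) :
  P 1%N -> (forall p a, prime p -> (0 < a)%N -> P (p ^ a)%N) ->
  (forall m n, (0 < m)%N -> (0 < n)%N -> coprime m n ->
     P m -> P n -> P (m * n)%N) ->
  forall n, (0 < n)%N -> P n.
Proof.
move=> P1 Pp PM n; elim/ltn_ind: n => n IH n0.
have [->//|n1] := eqVneq n 1%N.
have {}n1 : (1 < n)%N by rewrite ltn_neqAle eq_sym n1.
set p := pdiv n; have pp : prime p by apply: pdiv_prime.
have a0 : (0 < logn p n)%N by rewrite logn_gt0 mem_primes pp n0 pdiv_dvd.
have npE : (n`_p = p ^ logn p n)%N by rewrite p_part.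
have np1 : (1 < n`_p)%N by rewrite npE -(exp1n (logn p n)) ltn_exp2r // prime_gt1.
rewrite -(partnC p n0); apply: PM; rewrite ?part_gt0 ?coprime_partC //.
  by rewrite npE; apply: Pp.
apply: IH; rewrite ?part_gt0 //.
by rewrite -[X in (_ < X)%N](partnC p n0) ltn_Pmull ?part_gt0.
Qed.

Lemma regular_divn n : (0 < n)%N ->
  1%N \in A n /\ {in A n, forall d, (n %/ d)%N \in A n}.
Proof.
move: n; apply: coprime_ind => [|p a pp a0|m n m0 n0 cmn [m1 mA] [n1 nA]].
- rewrite (regular_one regA); split; first by rewrite inE.
  by move=> d; rewrite !inE => /eqP ->.
- have [t ta /(_ _ (leqnn _))] := regular_type regA pp a0.
  rewrite divnK // => ->; split.
    by apply/imfsetP; exists 0%N.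
  move=> d /imfsetP[j jI ->].
  have : j \in iota 0 (a %/ t).+1 := jI; rewrite mem_iota add0n ltnS /= => jle.
  apply/imfsetP; exists (a %/ t - j)%N.
    suff : (a %/ t - j)%N \in iota 0 (a %/ t).+1 by [].
    by rewrite mem_iota add0n ltnS leq_subr.
  rewrite mulnBl divnK // expnB ?prime_gt0 //.
  by rewrite -[X in (_ <= X)%N](divnK ta) leq_mul2r jle orbT.
- rewrite regular_mul //; split.
    by apply/imfset2P; exists 1%N => //=; exists 1%N.
  move=> _ /imfset2P[d /= dA [e /= eA ->]].
  have dm := regular_dvd regA m0 dA; have en := regular_dvd regA n0 eA.
  apply/imfset2P; exists (m %/ d)%N; first exact: mA.
  exists (n %/ e)%N; first exact: nA.
  have de0 : (0 < d * e)%N by rewrite muln_gt0 (dvdn_gt0 m0) ?(dvdn_gt0 n0).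
  apply/eqP; rewrite -(eqn_pmul2r de0) divnK ?dvdn_mul //.
  by rewrite mulnACA !divnK.
Qed.

Lemma regular_self n : (0 < n)%N -> n \in A n.
Proof. by move=> n0; have [A1 /(_ _ A1)] := regular_divn n0; rewrite divn1. Qed.

Variable K : nzRingType.

Lemma regular_sum_divn (g : nat -> K) n : (0 < n)%N ->
  \sum_(d <- A n) g (n %/ d)%N = \sum_(d <- A n) g d.
Proof.
move=> n0; rewrite -(big_map (fun d => n %/ d)%N xpredT g).
have [_ nA] := regular_divn n0.
have nK : {in A n, forall d, (n %/ (n %/ d))%N = d}.
  by move=> d /(regular_dvd regA n0) dn; rewrite divnA // mulKn.
apply: perm_big; apply: uniq_perm; rewrite ?fset_uniq //.
  rewrite map_inj_in_uniq ?fset_uniq // => d e dA eA /= de.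
  by rewrite -(nK _ dA) de nK.
move=> d; apply/mapP/idP => [[e eA ->]|dA]; first exact: nA.
by exists (n %/ d)%N; rewrite ?nK //; apply: nA.
Qed.

Lemma is_muAP (mu : nat -> K) : is_muA A mu <->
  forall n, (0 < n)%N -> \sum_(d <- A n) mu d = (n == 1%N)%:R.
Proof.
have E n : (0 < n)%N -> convA A (fun=> 1) mu n = \sum_(d <- A n) mu d.
  move=> n0; rewrite -regular_sum_divn //.
  by apply: eq_bigr => d _; rewrite mul1r.
have E' n : convA A mu (fun=> 1) n = \sum_(d <- A n) mu d.
  by apply: eq_bigr => d _; rewrite mulr1.
split=> H n n0; have := H n n0; rewrite E' E //; by [case | split].
Qed.

Lemma sum_regular_self (g : nat -> K) n : (0 < n)%N ->
  \sum_(d <- A n) g d = g n + \sum_(d <- A n | (d < n)%N) g d.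
Proof.
move=> n0; rewrite (bigD1_seq n) ?fset_uniq ?regular_self //=; congr (_ + _).
rewrite big_seq_cond [RHS]big_seq_cond; apply: eq_bigl => d.
case dA : (d \in _) => //=; rewrite ltn_neqAle.
by rewrite (dvdn_leq n0 (regular_dvd regA n0 dA)) andbT.
Qed.

Lemma is_muA_unique (mu nu : nat -> K) : is_muA A mu -> is_muA A nu ->
  forall n, (0 < n)%N -> mu n = nu n.
Proof.
move=> /is_muAP Hmu /is_muAP Hnu; elim/ltn_ind => n IH n0.
have := Hmu n n0; rewrite -(Hnu n n0) !sum_regular_self //.
rewrite [in X in X = _]big_seq_cond [in X in _ = X]big_seq_cond.
rewrite (eq_bigr nu) => [/addIr //|d /andP[dA dn]]; apply: IH => //.
exact: dvdn_gt0 n0 (regular_dvd regA n0 dA).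
Qed.

Fixpoint muA_rec (k n : nat) : K :=
  if k is k'.+1 then (n == 1%N)%:R - \sum_(d <- A n | (d < n)%N) muA_rec k' d
  else 0.

Lemma muA_recE k n : (n <= k)%N -> muA_rec k n = muA_rec n n.
Proof.
elim/ltn_ind: n k => -[|n] IH [|k] //= nk.
  by rewrite big_pred0 // subrr.
congr (_ - _); apply: eq_bigr => d dn.
by rewrite (IH d dn k (leq_trans dn nk)) (IH d dn n dn).
Qed.

Lemma is_muA_exists : exists mu : nat -> K, is_muA A mu.
Proof.
exists (fun n => muA_rec n n); apply/is_muAP => -[//|n] _.
rewrite sum_regular_self //= addrC -[RHS](subrK (\sum_(d <- A n.+1 | (d < n.+1)%N) muA_rec n d)).
rewrite addrC; congr (_ + _); apply: eq_bigr => d dn.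
by rewrite muA_recE.
Qed.

End Existence.

(* Main.v *)
(** The set A(n) is closed under lcm, and A(m) consists of the elements of A(n)
    dividing m whenever m is in A(n); hence A((k, n)_A) is the set of all e in
    A(n) dividing k, and Moebius inversion gives
      f((j - 1, n)_A) = \sum_(e in A(n), e | j - 1) (mu_A * f)(e).
    After exchanging sums, it remains to sum chi over the units j mod n with
    j = 1 mod e. This is phi(n) / phi(e) if d | e, since chi is then 1 on that
    subgroup. Otherwise chi is nontrivial on it, because the induced moduli are
    closed under gcd, and the sum vanishes. *)
Require Import Defs.
From mathcomp Require Import all_boot all_order all_algebra.
From mathcomp Require Import finmap.
From mathcomp Require Import reals complex.
From mathcomp Require Import ring.

Set Implicit Arguments.
Unset Strict Implicit.
Unset Printing Implicit Defensive.

Import Order.TTheory GRing.Theory Num.Theory.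
Local Open Scope ring_scope.

(** * Divisor structure of regular systems and Moebius inversion *)

Section RegularSystem.
Variables (A : nat -> {fset nat}) (regA : regular_system A).

Lemma regular_gt0 n d : (0 < n)%N -> d \in A n -> (0 < d)%N.
Proof. by move=> n0 /(regular_dvd regA n0)/(dvdn_gt0 n0). Qed.

(** Membership form of the prime power axiom, with [a] written as [s * t]: the prime power cases
    below become comparisons of exponents. *)
Lemma regular_expP p a : prime p -> (0 < a)%N ->
  exists2 t, (0 < t)%N & exists s, a = (s * t)%N /\
    forall i e, (i <= s)%N ->
      e \in A (p ^ (i * t))%N <-> exists2 j, (j <= i)%N & e = (p ^ (j * t))%N.
Proof.
move=> pp a0; have [t ta tA] := regular_type regA pp a0.
exists t; first exact: dvdn_gt0 a0 ta.
exists (a %/ t)%N; split=> [|i e ile]; first by rewrite divnK.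
rewrite tA //; split=> [/imfsetP|] [j ji ->]; last apply/imfsetP.
  by exists j => //; have : j \in iota 0 i.+1 := ji; rewrite mem_iota add0n.
by exists j => //; suff : j \in iota 0 i.+1 by []; rewrite mem_iota add0n.
Qed.

Lemma dvdn_mul_coprime m n d1 d2 e1 e2 : coprime m n ->
  (d1 %| m)%N -> (e1 %| m)%N -> (d2 %| n)%N -> (e2 %| n)%N ->
  (d1 * d2 %| e1 * e2)%N = (d1 %| e1)%N && (d2 %| e2)%N.
Proof.
move=> cmn d1m e1m d2n e2n.
have cop x y : (x %| m)%N -> (y %| n)%N -> coprime x y.
  by move=> xm yn; apply: coprime_dvdl xm (coprime_dvdr yn cmn).
rewrite Gauss_dvd ?cop // Gauss_dvdl ?cop // Gauss_dvdr //.
by rewrite coprime_sym cop.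
Qed.

(** At a prime power, all the sets [A (p ^ (i * t))] with [i <= s] share the same [t], so they are
    initial segments of one chain. Multiplicativity then treats coprime factors separately. *)
Lemma mem_regular_sub n : (0 < n)%N ->
  {in A n, forall m e, (e \in A m) = (e \in A n) && (e %| m)%N}.
Proof.
move: n; apply: coprime_ind => [|p a pp a0|m n m0 n0 cmn mA nA].
- move=> m; rewrite (regular_one regA) inE => /eqP-> e.
  by rewrite (regular_one regA) inE dvdn1 andbb.
- have [t t0 [s [-> tA]]] := regular_expP pp a0.
  move=> _ /(tA _ _ (leqnn s))[i ile ->] e.
  apply/idP/andP => [/(tA _ _ ile)[j jle ->]|[/(tA _ _ (leqnn s))[j jle ->]]].
    split; first by apply/(tA _ _ (leqnn s)); exists j => //; apply: leq_trans ile.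
    by rewrite dvdn_exp2l // leq_mul2r jle orbT.
  rewrite dvdn_Pexp2l ?prime_gt1 // leq_pmul2r // => ji.
  by apply/(tA _ _ ile); exists j.
- move=> x + e; rewrite regular_mul // => /imfset2P[m1 /= m1A [n1 /= n1A ->]].
  have [m1m n1n] := (regular_dvd regA m0 m1A, regular_dvd regA n0 n1A).
  have c1 : coprime m1 n1 by apply: coprime_dvdl m1m (coprime_dvdr n1n cmn).
  rewrite (regular_mul regA) ?(regular_gt0 m0 m1A) ?(regular_gt0 n0 n1A) //.
  apply/imfset2P/andP => [[e1 /= + [e2 /= + ->]]|[]].
    rewrite (mA _ m1A) (nA _ n1A) => /andP[e1A e1m] /andP[e2A e2n].
    by split; rewrite ?dvdn_mul //; apply/imfset2P; exists e1 => //; exists e2.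
  move=> /imfset2P[e1 /= e1A [e2 /= e2A ->]].
  rewrite (dvdn_mul_coprime cmn) ?(regular_dvd regA m0) ?(regular_dvd regA n0) //.
  move=> /andP[e1m e2n]; exists e1; first by rewrite /= (mA _ m1A) e1A.
  by exists e2; rewrite //= (nA _ n1A) e2A.
Qed.

(** At a prime power the set is a chain for divisibility, so the lcm is one of the two elements;
    over coprime factors the lcm is formed componentwise. *)
Lemma regular_lcm n : (0 < n)%N -> {in A n &, forall d e, lcmn d e \in A n}.
Proof.
move: n; apply: coprime_ind => [|p a pp a0|m n m0 n0 cmn mA nA].
- by move=> d e; rewrite (regular_one regA) !inE => /eqP-> /eqP->.
- have [t t0 [s [-> tA]]] := regular_expP pp a0.
  move=> d e /(tA _ _ (leqnn s))[i ile ->] /(tA _ _ (leqnn s))[j jle ->].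
  wlog ij : i j ile jle / (i <= j)%N.
    by move=> H; case/orP: (leq_total i j) => ?; [|rewrite lcmnC]; apply: H.
  have /lcmn_idPl : (p ^ (i * t) %| p ^ (j * t))%N.
    by rewrite dvdn_exp2l // leq_mul2r ij orbT.
  rewrite lcmnC => ->.
  by apply/(tA _ _ (leqnn s)); exists j.
- move=> d e; rewrite regular_mul //.
  move=> /imfset2P[d1 /= d1A [d2 /= d2A ->]] /imfset2P[e1 /= e1A [e2 /= e2A ->]].
  apply/imfset2P; exists (lcmn d1 e1); first exact: mA.
  exists (lcmn d2 e2); first exact: nA.
  have c1 : coprime (lcmn d1 e1) (lcmn d2 e2).
    apply: (@coprime_dvdl _ m); first by rewrite dvdn_lcm !(regular_dvd regA m0).
    by apply: (@coprime_dvdr _ n) => //; rewrite dvdn_lcm !(regular_dvd regA n0).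
  apply/eqP; rewrite eqn_dvd dvdn_lcm !dvdn_mul ?dvdn_lcml ?dvdn_lcmr //=.
  rewrite Gauss_dvd // !dvdn_lcm.
  rewrite (dvdn_trans _ (dvdn_lcml _ _)) ?dvdn_mulr //.
  rewrite (dvdn_trans _ (dvdn_lcmr _ _)) ?dvdn_mulr //.
  rewrite (dvdn_trans _ (dvdn_lcml _ _)) ?dvdn_mull //.
  by rewrite (dvdn_trans _ (dvdn_lcmr _ _)) ?dvdn_mull.
Qed.

(** The maximum is also greatest for divisibility: its lcm with any [e] in [A n] dividing [k] is
    again such a divisor, hence cannot exceed it. *)
Lemma gcdAP k n : (0 < n)%N ->
  gcdA A k n \in A n /\
  {in A n, forall e, (e%:Z %| k)%Z = (e %| gcdA A k n)%N}.
Proof.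
move=> n0; have [A1 _] := regular_divn regA n0.
have [gA gk] : gcdA A k n \in A n /\ ((gcdA A k n)%:Z %| k)%Z.
  (* Since 1 is a candidate, the maximum is positive; this excludes the default value 0 of an empty
     maximum in the induction. *)
  have : (0 < gcdA A k n)%N.
    by apply: (leq_bigmax_seq (P := fun d : nat => (d%:Z %| k)%Z) (F := id)).
  rewrite /gcdA big_seq_cond.
  elim/big_ind: _ => // [x y IHx IHy|i /andP[]//].
  by rewrite /maxn; case: ifP.
split=> // e eA; apply/idP/idP => [ek|eg]; last first.
  by apply: dvdz_trans gk.
have lA := regular_lcm n0 eA gA.
have lk : ((lcmn e (gcdA A k n))%:Z %| k)%Z.
  by move: ek gk; rewrite !dvdzE /= dvdn_lcm => -> ->.
have ll : (lcmn e (gcdA A k n) <= gcdA A k n)%N.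
  exact: (leq_bigmax_seq (P := fun d : nat => (d%:Z %| k)%Z) (F := id)).
have <- : lcmn e (gcdA A k n) = gcdA A k n.
  apply/eqP; rewrite eqn_leq ll dvdn_leq ?dvdn_lcmr //.
  exact: regular_gt0 n0 lA.
exact: dvdn_lcml.
Qed.

Lemma sum_regular_sub (V : nmodType) (g : nat -> V) n m : (0 < n)%N ->
  m \in A n -> \sum_(e <- A m) g e = \sum_(e <- A n | (e %| m)%N) g e.
Proof.
move=> n0 mA; rewrite -[RHS]big_filter; apply: perm_big.
apply: uniq_perm; rewrite ?filter_uniq ?fset_uniq // => e.
by rewrite mem_filter (mem_regular_sub n0 mA) andbC.
Qed.

(** After expanding and exchanging sums, the coefficient of [f b] is the sum of [mu] over
    [A (m %/ b)], which is 1 if [b = m] and 0 otherwise. *)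
Lemma sum_convA_mu (K : nzRingType) (mu f : nat -> K) m :
  is_muA A mu -> (0 < m)%N -> \sum_(e <- A m) convA A mu f e = f m.
Proof.
move=> /(is_muAP regA) muP m0.
have divA b : b \in A m -> (m %/ b)%N \in A m.
  by have [_] := regular_divn regA m0; apply.
have inner e : e \in A m ->
    convA A mu f e = \sum_(b <- A m | (b %| e)%N) mu (e %/ b)%N * f b.
  move=> eA; have e0 := regular_gt0 m0 eA.
  rewrite -(sum_regular_sub _ m0 eA) -(regular_sum_divn regA) //.
  rewrite /convA big_seq [RHS]big_seq; apply: eq_bigr => b bA.
  by rewrite divnA ?mulKn // (regular_dvd regA e0).
rewrite big_seq (eq_bigr _ inner) -big_seq.
rewrite (exchange_big_dep xpredT) //=.
rewrite (bigD1_seq m) ?fset_uniq ?regular_self //=.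
have muS b : b \in A m ->
    \sum_(e <- A m | (b %| e)%N) mu (e %/ b)%N * f b = (b == m)%:R * f b.
  move=> bA; have b0 := regular_gt0 m0 bA; have bm := regular_dvd regA m0 bA.
  rewrite -mulr_suml; congr (_ * _).
  have mb0 : (0 < m %/ b)%N by rewrite divn_gt0 // dvdn_leq.
  (* Replacing [e] by [m %/ c] turns the condition that [b] divides [e] into [c] divides [m %/ b],
     that is, [c] lies in [A (m %/ b)]. *)
  rewrite big_mkcond -(regular_sum_divn regA) //= -big_mkcond /=.
  transitivity (\sum_(c <- A (m %/ b)%N) mu (m %/ b %/ c)%N).
    rewrite (sum_regular_sub _ m0) ?divA // big_seq_cond [RHS]big_seq_cond.
    apply: eq_big => [c|c _]; last by rewrite -!divnMA mulnC.
    case cA: (c \in A m) => //=; have cm := regular_dvd regA m0 cA.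
    by rewrite !dvdn_divRL // mulnC.
  rewrite (regular_sum_divn regA) // muP //.
  by rewrite eq_sym eqn_div // mul1n.
rewrite muS ?regular_self // eqxx mul1r big_seq_cond big1 ?addr0 //.
by move=> b /andP[bA /negPf bm]; rewrite muS // bm mul0r.
Qed.

End RegularSystem.

(** * Units modulo n: inverses and lifting from a divisor of n *)

Lemma coprimez_eqmod (n : nat) (a b : int) :
  (n%:Z %| a - b)%Z -> coprimez a n = coprimez b n.
Proof.
by rewrite -eqz_mod_dvd /coprimez -gcdz_modl => /eqP->; rewrite gcdz_modl.
Qed.

Lemma coprimez_inv (u : int) (n : nat) :
  coprimez u n -> exists v : int, (n%:Z %| v * u - 1)%Z.
Proof.
case/coprimezP=> -[v w] /= <-; exists v.
by rewrite opprD addNKr rpredN dvdz_mull.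
Qed.

Lemma lift_coprimez (m n : nat) (a : int) : (0 < n)%N -> (m %| n)%N ->
  coprimez a m -> exists2 b : int, coprimez b n & (m%:Z %| b - a)%Z.
Proof.
(* a + m k works, where k is the part of n prime to a: a prime divisor of n
   divides exactly one of a and k, and divides m only if it does not divide a. *)
move=> n0 mn cam; pose k := (n`_[pred p | ~~ (p %| `|a|)])%N.
exists (a + m%:Z * k%:Z); last by rewrite addrC addKr dvdz_mulr.
rewrite coprimezE; set b := a + _; apply/negPn/negP => nc.
have [p pp] : exists2 p, prime p & (p %| gcdn `|b| n)%N.
  exists (pdiv (gcdn `|b| n)); last exact: pdiv_dvd.
  by apply: pdiv_prime; rewrite ltn_neqAle eq_sym nc gcdn_gt0 n0 orbT.
rewrite dvdn_gcd => /andP[pb pn].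
have pbz : (p%:Z %| b)%Z by rewrite dvdzE.
have pk : (p %| k)%N = ~~ (p %| `|a|)%N.
  apply/idP/idP => [pk|npa].
    by have := pnat_dvd pk (part_pnat _ _); rewrite pnatE.
  rewrite -(part_pnat_id (pnat_id pp)) /k.
  apply: dvdn_trans (partn_dvd _ n0 pn) _.
  by apply: sub_in_partn => q _ /eqP->.
case pa: (p %| `|a|)%N pk => /= pk; last first.
  have : (p%:Z %| a)%Z by rewrite -(rpredDr _ (x := m%:Z * k%:Z)) // dvdz_mull.
  by rewrite dvdzE pa.
have : (p%:Z %| m%:Z * k%:Z)%Z by rewrite -(rpredDl _ (x := a)) // dvdzE.
rewrite dvdzE abszM Euclid_dvdM // pk orbF => pm.
have := coprime_dvdl pa (coprime_dvdr pm cam).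
by rewrite /coprime gcdnn => /eqP p1; rewrite p1 in pp.
Qed.

(** * Sums of periodic functions over a full set of residues *)

Section PeriodicSums.
Variables (V : nmodType) (n : nat) (F : int -> V).
Hypothesis FD : forall a, F (a + n%:Z) = F a.

Lemma periodic_eqmod (a b : int) : (n%:Z %| a - b)%Z -> F a = F b.
Proof.
have FM (k : nat) c : F (c + k%:Z * n%:Z) = F c.
  elim: k => [|k IH]; first by rewrite mul0r addr0.
  by rewrite -addn1 PoszD mulrDl mul1r addrA FD.
move=> /dvdzP[q /eqP]; rewrite subr_eq addrC => /eqP->.
case: q => q; first exact: FM.
by rewrite -(FM q.+1) NegzE mulNr subrK.
Qed.

Lemma sum_periodic_shift :
  \sum_(1 <= j < n.+1) F j%:Z = \sum_(j < n) F j%:Z.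
Proof.
case: n FD => [|m] FDm; first by rewrite big_geq // big_ord0.
rewrite big_nat_recr //= big_ord_recl addrC -(FDm 0) add0r; congr (_ + _).
by rewrite big_add1 big_mkord.
Qed.

(** Multiplication by a unit is injective on residues, hence permutes them. *)
Lemma sum_periodic_mul (u : int) : coprimez u n ->
  \sum_(j < n) F (u * j%:Z) = \sum_(j < n) F j%:Z.
Proof.
case: n F FD periodic_eqmod => [|m] G GD Gmod cu; first by rewrite !big_ord0.
pose h (j : 'I_m.+1) : 'I_m.+1 := inord `|((u * j%:Z) %% m.+1%:Z)%Z|.
have hE j : (h j)%:Z = ((u * j%:Z) %% m.+1%:Z)%Z.
  rewrite /h inordK ?gez0_abs ?modz_ge0 //.
  by rewrite -ltz_nat gez0_abs ?modz_ge0 // ltz_pmod.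
have h_inj : injective h.
  move=> i j /(congr1 (fun k : 'I_m.+1 => k%:Z)); rewrite !hE => /eqP.
  rewrite eqz_mod_dvd -mulrBr Gauss_dvdzr; last by rewrite coprimez_sym.
  rewrite -eqz_mod_dvd !modz_nat !modn_small // => /eqP[] ij.
  exact: val_inj.
rewrite [RHS](reindex_inj h_inj); apply: eq_bigr => j _; apply: Gmod.
by rewrite hE -eqz_mod_dvd modz_mod.
Qed.

End PeriodicSums.

(** * Counting the units modulo n in a residue class modulo e *)

Section UnitsInProgression.
Variables (K : pzSemiRingType) (n e : nat).
Hypotheses (n_gt0 : (0 < n)%N) (en : (e %| n)%N).

Lemma sum_coprime_totient (m : nat) :
  \sum_(j < m) (coprimez j%:Z m)%:R = (totient m)%:R :> K.
Proof.
rewrite totient_count_coprime big_mkord natr_sum; apply: eq_bigr => j _.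
by rewrite coprimezE coprime_sym.
Qed.

(** Lift [r] to a unit [u] modulo [n]: multiplication by [u] permutes the units and carries the
    class of 1 modulo [e] to that of [r]. *)
Lemma count_units_progression (r : int) : coprimez r e ->
  \sum_(j < n) (coprimez j%:Z n && (e%:Z %| j%:Z - r)%Z)%:R
    = \sum_(j < n) (coprimez j%:Z n && (e%:Z %| j%:Z - 1)%Z)%:R :> K.
Proof.
move=> cre; have [u cun ur] := lift_coprimez n_gt0 en cre.
rewrite -(@sum_periodic_mul K n
  (fun a => (coprimez a n && (e%:Z %| a - r)%Z)%:R) _ u) //.
  apply: eq_bigr => j _; rewrite coprimezMl cun /=.
  have -> : u * j%:Z - r = (u - r) + u * (j%:Z - 1) by ring.
  rewrite rpredDl // Gauss_dvdzr // coprimez_sym.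
  exact: coprimez_dvdr en cun.
move=> a; rewrite (@coprimez_eqmod n (a + n%:Z) a); last first.
  by rewrite addrC addKr.
by rewrite addrAC rpredDr.
Qed.

(** Sort the units modulo [n] by their residue modulo [e]: only the [totient e] classes prime to [e]
    occur, all equally often. *)
Lemma sum_units_progression :
  \sum_(j < n) (coprimez j%:Z n && (e%:Z %| j%:Z - 1)%Z)%:R * (totient e)%:R
    = (totient n)%:R :> K.
Proof.
have e0 := dvdn_gt0 n_gt0 en.
rewrite -(sum_coprime_totient n) -(sum_coprime_totient e).
case: e e0 en count_units_progression => // m _ mn cntU.
pose h (j : 'I_n) : 'I_m.+1 := inord (j %% m.+1).
rewrite [RHS](partition_big h xpredT) //= -mulr_suml mulr_sumr.
apply: eq_bigr => r _.
have -> : \sum_(j < n | h j == r) (coprimez j%:Z n)%:R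
    = \sum_(j < n) (coprimez j%:Z n && (m.+1%:Z %| j%:Z - r%:Z)%Z)%:R :> K.
  rewrite big_mkcond; apply: eq_bigr => j _.
  have -> : (h j == r) = (m.+1%:Z %| j%:Z - r%:Z)%Z.
    rewrite -eqz_mod_dvd !modz_nat (modn_small (ltn_ord r)) eqz_nat.
    by rewrite -val_eqE /= inordK // ltn_pmod.
  by case: ifP; rewrite ?andbT ?andbF.
case cr: (coprimez r%:Z m.+1); first by rewrite mulr1 cntU.
rewrite mulr0 big1 // => j _; case: andP => // -[cj jr].
by rewrite -(coprimez_eqmod jr) (coprimez_dvdr mn cj) in cr.
Qed.

End UnitsInProgression.

(** * Induced moduli, the conductor, and character sums over progressions *)

Section Character.
Variables (K : idomainType) (n : nat) (chi : int -> K).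
Hypotheses (n_gt0 : (0 < n)%N) (chi_char : dirichlet_character n chi).

Lemma dirichlet_eq0 a : ~~ coprimez a n -> chi a = 0.
Proof. by rewrite -(dirichlet_neq0 chi_char) => /negPn/eqP. Qed.

Lemma dirichlet1 : chi 1 = 1.
Proof.
have c1 : chi 1 != 0 by rewrite (dirichlet_neq0 chi_char) coprimezE coprime1n.
by apply: (mulIf c1); rewrite -(dirichletM chi_char) !mul1r.
Qed.

Lemma dirichlet_eqmod (a b : int) : (n%:Z %| a - b)%Z -> chi a = chi b.
Proof. exact: periodic_eqmod (dirichlet_periodic chi_char) _ _. Qed.

Lemma induced_modulusP d : induced_modulus n chi d <->
  (d %| n)%N /\
  forall a : int, coprimez a n -> (d%:Z %| a - 1)%Z -> chi a = 1.
Proof.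
split=> -[dn H]; split=> // a ca.
  by rewrite -eqz_mod_dvd => /eqP/H; apply.
by move=> /eqP; rewrite eqz_mod_dvd; apply: H.
Qed.

(* A unit congruent to 1 modulo gcd d e is a product of units congruent to 1
   modulo d and e respectively. *)
Lemma induced_modulus_gcd d e : induced_modulus n chi d ->
  induced_modulus n chi e -> induced_modulus n chi (gcdn d e).
Proof.
move=> /induced_modulusP[dn chid] /induced_modulusP[en chie].
apply/induced_modulusP; split; first exact: dvdn_trans (dvdn_gcdl d e) dn.
move=> a ca /dvdzP[q aE].
have [u [v uvE]] := Bezoutz d e; rewrite /gcdz /= in uvE.
(* By Bezout, [a - 1] is [q * (u * d + v * e)]; keeping only the first term gives [b0], congruent to
   1 modulo [d] and to [a] modulo [e]. *)
pose b0 := 1 + q * u * d%:Z.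
have b0d : (d%:Z %| b0 - 1)%Z by rewrite /b0 addrC addKr dvdz_mull.
have b0e : (e%:Z %| b0 - a)%Z.
  have -> : b0 - a = - (q * v) * e%:Z.
    by rewrite -[a](subrK 1) aE -uvE /b0; ring.
  exact: dvdz_mull.
have cb0 : coprimez b0 (lcmn d e).
  have cd : coprimez b0 d by rewrite (coprimez_eqmod b0d) coprimezE coprime1n.
  have ce : coprimez b0 e.
    by rewrite (coprimez_eqmod b0e) (coprimez_dvdr en).
  apply: (@coprimez_dvdr _ (d * e)%N); last by rewrite PoszM coprimezMr cd.
  by rewrite dvdn_lcm dvdn_mulr ?dvdn_mull.
have ln : (lcmn d e %| n)%N by rewrite dvdn_lcm dn.
(* [b0] is a unit only modulo [lcmn d e], so it is lifted to a unit [b] modulo [n]. With [w] inverse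
   to [b], the second factor of [a] is [w * a]. *)
have [b cb bb0] := lift_coprimez n_gt0 ln cb0.
have chib : chi b = 1.
  apply: chid => //; rewrite -[b](subrK b0) -addrA rpredD //.
  by apply: dvdz_trans bb0; rewrite dvdzE dvdn_lcml.
have [w wb] := coprimez_inv cb.
have chiw : chi w = 1.
  by rewrite -[chi w]mulr1 -chib -(dirichletM chi_char) (dirichlet_eqmod wb) dirichlet1.
have cw : coprimez w n by rewrite -(dirichlet_neq0 chi_char) chiw oner_neq0.
suff: chi (w * a) = 1 by rewrite (dirichletM chi_char) chiw mul1r.
apply: chie.
  by rewrite coprimezMl cw.
have -> : w * a - 1 = (w * b - 1) - w * ((b - b0) + (b0 - a)) by ring.
rewrite rpredB //; first exact: dvdz_trans wb.
rewrite dvdz_mull // rpredD //.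
by apply: dvdz_trans bb0; rewrite dvdzE dvdn_lcmr.
Qed.

(** By minimality [d] cannot exceed the induced modulus [gcdn d e], so it equals this gcd. *)
Lemma conductor_dvdn d e : conductor n chi d -> induced_modulus n chi e ->
  (d %| e)%N.
Proof.
move=> [indd mind] inde; have indg := induced_modulus_gcd indd inde.
have d0 : (0 < d)%N by apply: dvdn_gt0 n_gt0 indd.1.
suff <- : gcdn d e = d by apply: dvdn_gcdr.
by apply/eqP; rewrite eqn_leq mind // dvdn_leq // dvdn_gcdl.
Qed.

Lemma sum_chi_progression d e : conductor n chi d -> (e %| n)%N ->
  (\sum_(j < n | (e%:Z %| j%:Z - 1)%Z) chi j%:Z) * (totient e)%:R
    = (if (d %| e)%N then (totient n)%:R else 0).
Proof.
move=> condd en; case: ifPn => [de|nde].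
  rewrite -(sum_units_progression K n_gt0 en) -mulr_suml; congr (_ * _).
  rewrite big_mkcond; apply: eq_bigr => j _.
  case: ifP => je; last by rewrite andbF.
  rewrite andbT; case cj: (coprimez j%:Z n) => /=; last first.
    by rewrite dirichlet_eq0 // cj.
  have [/induced_modulusP[_ chid] _] := condd.
  by apply: chid => //; apply: dvdz_trans je.
suff -> : \sum_(j < n | (e%:Z %| j%:Z - 1)%Z) chi j%:Z = 0 by rewrite mul0r.
(* If [S] were nonzero, multiplying by a unit [a] congruent to 1 modulo [e] would permute its terms,
   so [chi a * S = S] and [chi a = 1]. Then [e] would be an induced modulus, hence a multiple of
   [d]. *)
set S := LHS; apply/eqP; case: (eqVneq S 0) => // S0.
case/negP: nde; apply: (conductor_dvdn condd); apply/induced_modulusP.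
split=> // a ca ae; apply: (mulIf S0); rewrite mul1r.
rewrite /S mulr_sumr !(big_mkcond (fun j : 'I_n => (e%:Z %| j%:Z - 1)%Z)) /=.
rewrite -[RHS](@sum_periodic_mul K n
  (fun b => if (e%:Z %| b - 1)%Z then chi b else 0) _ a) //.
  apply: eq_bigr => j _; rewrite (dirichletM chi_char).
  suff -> : (e%:Z %| a * j%:Z - 1)%Z = (e%:Z %| j%:Z - 1)%Z by [].
  have -> : a * j%:Z - 1 = (a - 1) + a * (j%:Z - 1) by ring.
  rewrite rpredDl // Gauss_dvdzr // coprimez_sym.
  exact: coprimez_dvdr en ca.
by move=> b; rewrite addrAC rpredDr // (dirichlet_periodic chi_char).
Qed.

End Character.

(** * Exchange of sums, and reindexing by multiples of the conductor *)

Theorem theorem9 (R : realType) (A : nat -> {fset nat}) (regA : regular_system A)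
    (muA : nat -> R[i]) (muA_inv : is_muA A muA) (f : nat -> R[i])
    (n : nat) (n_gt0 : (0 < n)%N)
    (chi : int -> R[i]) (chi_char : dirichlet_character n chi)
    (d : nat) (chi_cond : conductor n chi d) :
  \sum_(1 <= j < n.+1) f (gcdA A (j%:Z - 1) n) * chi j%:Z
    = (totient n)%:R *
      \sum_(1 <= delta < n.+1 | (d * delta)%N \in A n)
         convA A muA f (d * delta)%N / (totient (d * delta)%N)%:R
  /\ (primitive_character n chi ->
      \sum_(1 <= j < n.+1) f (gcdA A (j%:Z - 1) n) * chi j%:Z
        = convA A muA f n).
Proof.
have tot_neq0 m : (0 < m)%N -> (totient m)%:R != 0 :> R[i].
  by move=> m0; rewrite pnatr_eq0 -lt0n totient_gt0.
have dn : (d %| n)%N by case: chi_cond => -[].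
have d0 : (0 < d)%N := dvdn_gt0 n_gt0 dn.
set L := LHS; set Rhs := RHS.
have eqLR : L = Rhs; last first.
  (* The primitive case follows from the formula: minimality gives [d = n], and [n * delta] divides
     [n] only for [delta = 1]. *)
  split=> // -[_ [_ minn]]; rewrite -/L eqLR /Rhs.
  have dE : d = n.
    by apply/eqP; rewrite eqn_leq dvdn_leq //= minn //; case: chi_cond.
  rewrite dE big_ltn_cond // muln1 regular_self // big_nat_cond big_pred0.
    by rewrite addr0 mulrCA divff ?mulr1 ?tot_neq0.
  move=> j; apply/negP => /andP[/andP[j1 _] /(regular_dvd regA n_gt0)].
  by rewrite -[X in (_ %| X)%N]muln1 dvdn_pmul2l // dvdn1 => /eqP jE; rewrite jE in j1.
have gE (k : int) : f (gcdA A k n) =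
    \sum_(e <- A n | (e%:Z %| k)%Z) convA A muA f e.
  have [gA gP] := gcdAP regA k n_gt0.
  rewrite -(sum_convA_mu regA f muA_inv (regular_gt0 regA n_gt0 gA)).
  rewrite (sum_regular_sub regA _ n_gt0 gA) big_seq_cond [RHS]big_seq_cond.
  by apply: eq_bigl => e; case eA: (e \in A n) => //=; rewrite gP.
pose S e := \sum_(1 <= j < n.+1 | (e%:Z %| j%:Z - 1)%Z) chi j%:Z.
have SE e : e \in A n ->
    S e = if (d %| e)%N then (totient n)%:R / (totient e)%:R else 0.
  move=> eA; have en := regular_dvd regA n_gt0 eA.
  have e0 := tot_neq0 _ (regular_gt0 regA n_gt0 eA).
  apply: (mulIf e0); rewrite (fun_if (fun x => x * _)) divfK // mul0r.
  rewrite -(sum_chi_progression n_gt0 chi_char chi_cond en); congr (_ * _).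
  (* The range 1 to [n] is traded for 0 to [n - 1]; the condition on [j] is periodic too, because
     [e] divides [n]. *)
  rewrite /S big_mkcond [RHS]big_mkcond /=.
  apply: (@sum_periodic_shift _ n
    (fun b => if (e%:Z %| b - 1)%Z then chi b else 0)) => b.
  by rewrite addrAC rpredDr // (dirichlet_periodic chi_char).
have -> : L = \sum_(e <- A n) convA A muA f e * S e.
  rewrite /L; under eq_bigr do rewrite gE mulr_suml.
  rewrite (exchange_big_dep xpredT) //=; apply: eq_bigr => e _.
  by rewrite mulr_sumr.
have -> : \sum_(e <- A n) convA A muA f e * S e = (totient n)%:R *
    \sum_(e <- A n | (d %| e)%N) convA A muA f e / (totient e)%:R.
  rewrite mulr_sumr [RHS]big_mkcond big_seq [RHS]big_seq.
  apply: eq_bigr => e eA; rewrite SE //.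
  by case: ifP => _; rewrite ?mulr0 // mulrCA.
(* Put [e = d * delta]; the bound [delta <= n] loses no term, since [e] divides [n]. *)
congr (_ * _); rewrite -big_filter -[RHS]big_filter.
rewrite -(big_map (muln d) xpredT (fun e => convA A muA f e / (totient e)%:R)).
apply: perm_big; apply: uniq_perm.
- by rewrite filter_uniq ?fset_uniq.
- rewrite map_inj_uniq ?filter_uniq ?iota_uniq //.
  by move=> x y /eqP; rewrite eqn_pmul2l // => /eqP.
- move=> e; rewrite mem_filter; apply/andP/mapP => [[de eA]|[k]].
    have e0 := regular_gt0 regA n_gt0 eA.
    exists (e %/ d)%N; last by rewrite mulnC divnK.
    rewrite mem_filter mulnC divnK // eA mem_index_iota divn_gt0 //= ltnS.
    rewrite dvdn_leq //= (leq_trans (leq_div _ _)) // dvdn_leq //.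
    exact: regular_dvd eA.
  by rewrite mem_filter => /andP[kA _] ->; rewrite dvdn_mulr.
Qed.
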